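(* Let $\mathcal F(x_1,x_2,s)=A(x_1,x_2)s^2+B(x_1,x_2)s+C(x_1,x_2)$ be a polynomial of degree two in each of the three variables $x_1,x_2,s$ which is discriminantly separable, i.e. there are one-variable polynomials $P,J$ with $$B^2-4AC=4P(x_1)P(x_2),\quad \mathcal D_{x_1}(\mathcal F)(s,x_2)=4P(x_2)J(s),\quad \mathcal D_{x_2}(\mathcal F)(s,x_1)=4P(x_1)J(s).$$ Suppose that a given system of differential equations reduces to $$2\dot x_1=-if_1,\quad \dot e_1=-me_1,\qquad 2\dot x_2=if_2,\quad \dot e_2=me_2,$$ where $m$ is some function of the system's variables and $$f_1^2=P(x_1)-\frac{C(x_1,x_2)}{e_2},\qquad f_2^2=P(x_2)-\frac{C(x_1,x_2)}{e_1},$$ and that its integrals reduce to $$P(x_2)e_1+P(x_1)e_2=C(x_1,x_2)-e_1e_2A(x_1,x_2).$$ Then the system is linearized on the Jacobian of the curve $$y^2=J(z)(z-k)(z+k),$$ where $k$ is a constant such that $e_1e_2=k^2$.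
   Context: $\mathcal D_{u}(\mathcal F)$ denotes the discriminant of $\mathcal F$ regarded as a quadratic polynomial in the variable $u$. All variables are complex; the dot is $d/dt$. The system is in variables $x_1,x_2,e_1,e_2,r,\gamma_3$ and the equations for $\dot r,\dot\gamma_3$ are not specified. The product $e_1e_2$ is constant along solutions by the equations for $\dot e_1,\dot e_2$; $k$ is a constant with $e_1e_2=k^2$. ''Linearized on the Jacobian of the curve $y^2=\Phi(z)$'', with $\Phi(z)=J(z)(z-k)(z+k)$ (of degree at most six; the curve has genus two when $\Phi$ has degree five or six with distinct roots), means: if $s_1,s_2$ denote the two roots of $\mathcal F(x_1,x_2,s)=0$ in $s$, then along the solutions of the system (where the quantities are defined) $$\frac{ds_1}{\sqrt{\Phi(s_1)}}+\frac{ds_2}{\sqrt{\Phi(s_2)}}=c_0\,dt,\qquad \frac{s_1\,ds_1}{\sqrt{\Phi(s_1)}}+\frac{s_2\,ds_2}{\sqrt{\Phi(s_2)}}=c_1\,dt$$ with constants $c_0,c_1$ not both zero, i.e. the image of the pair of points over $s_1,s_2$ under the Abel map moves linearly in $t$. All square roots (including $f_1,f_2$, which are given only through their squares) are understood with suitable choices of branches.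
   Formalization: F is also assumed irreducible in s over C(x1,x2) (automatic if J is squarefree and non-constant); without it the claim fails, e.g. F=2(s-x1-x2)(s-x1-x2-1), P=J=1. The branches of f1,f2 are chosen with f1f2=σB/2, where the sign σ depends only on F,P,J. *)

(* Defs.v *)
From HB Require Import structures.
From mathcomp Require Import all_boot all_order all_algebra complex polyXY.
From mathcomp Require Import all_classical all_reals all_analysis.
Import Order.TTheory GRing.Theory Num.Theory.
Import numFieldNormedType.Exports.

Set Implicit Arguments.
Unset Strict Implicit.
Unset Printing Implicit Defensive.

Local Open Scope classical_set_scope.
Local Open Scope ring_scope.

Definition disc2 (T : nzRingType) (q : {poly T}) : T :=
  q`_1 ^+ 2 - 4 * (q`_2 * q`_0).

(* F(x1, x2, s) = A(x1, x2) s^2 + B(x1, x2) s + C(x1, x2) is stored as an element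
   of K[x2][x1][s]. *)
Definition coefA (K : fieldType) (F : {poly {poly {poly K}}}) (x1 x2 : K) : K :=
  (F`_2).[x1, x2].

Definition coefB (K : fieldType) (F : {poly {poly {poly K}}}) (x1 x2 : K) : K :=
  (F`_1).[x1, x2].

Definition coefC (K : fieldType) (F : {poly {poly {poly K}}}) (x1 x2 : K) : K :=
  (F`_0).[x1, x2].

(* The same polynomial in K[x2][s][x1] and in K[x1][s][x2]. *)
Definition as_poly_x1 (K : fieldType) (F : {poly {poly {poly K}}}) :
  {poly {poly {poly K}}} := swapXY F.

Definition as_poly_x2 (K : fieldType) (F : {poly {poly {poly K}}}) :
  {poly {poly {poly K}}} := swapXY (map_poly (@swapXY K) F).

(* For q : {poly K}, the bivariate polynomial q^:P is q in the outer variable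
   and q%:P is q in the inner one.  Over the complex numbers these identities
   do not force irreducible_poly F (irreducibility in s over K(x1, x2)):
   F = 2 (s - x1 - x2) (s - x1 - x2 - 1) satisfies them with P = J = 1.  They
   do force it when J is squarefree and not constant. *)
Record discriminantly_separable (K : fieldType) (F : {poly {poly {poly K}}})
    (P J : {poly K}) : Prop := DiscriminantlySeparable {
  ds_deg_s : size F = 3%N;
  ds_deg_x1 : size (as_poly_x1 F) = 3%N;
  ds_deg_x2 : size (as_poly_x2 F) = 3%N;
  ds_disc_s : disc2 F = 4 * (P^:P * P%:P);
  ds_disc_x1 : disc2 (as_poly_x1 F) = 4 * (P%:P * J^:P);
  ds_disc_x2 : disc2 (as_poly_x2 F) = 4 * (P%:P * J^:P)
}.

(* Derivative at a real time of a complex-valued function. *)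
Definition has_deriv (R : realType) (f : R -> R[i]) (t : R) (v : R[i]) : Prop :=
  ((h%:C)%C^-1 * (f (t + h) - f t) : R[i]^o) @[h --> (0 : R)^'] --> (v : R[i]^o).

Record state (K : Type) := State {
  vx1 : K; vx2 : K; ve1 : K; ve2 : K; vr : K; vg3 : K }.

(* z solves the system at time t, f1 and f2 being the chosen branches of the
   square roots.  The equations for f1^2 and f2^2 and the integral imply
   (f1 f2)^2 = P(x1) P(x2) + A C = (B / 2)^2, hence f1 f2 = B / 2 or
   f1 f2 = - B / 2; the sign sg records which of these two branches is taken.
   The signs of f1 and f2 are otherwise free.  The right-hand sides g_r and
   g_g3 of the equations for r and gamma_3 are arbitrary. *)
Record solves_at (R : realType) (F : {poly {poly {poly R[i]}}})
    (P : {poly R[i]}) (sg : R[i]) (m g_r g_g3 : state R[i] -> R[i])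
    (z : R -> state R[i]) (f1 f2 : R -> R[i]^o) (t : R) : Prop := SolvesAt {
  sol_x1 : has_deriv (fun u => 2 * vx1 (z u)) t (- 'i * f1 t);
  sol_e1 : has_deriv (fun u => ve1 (z u)) t (- m (z t) * ve1 (z t));
  sol_x2 : has_deriv (fun u => 2 * vx2 (z u)) t ('i * f2 t);
  sol_e2 : has_deriv (fun u => ve2 (z u)) t (m (z t) * ve2 (z t));
  sol_r : has_deriv (fun u => vr (z u)) t (g_r (z t));
  sol_g3 : has_deriv (fun u => vg3 (z u)) t (g_g3 (z t));
  sol_e1_neq0 : ve1 (z t) != 0;
  sol_e2_neq0 : ve2 (z t) != 0;
  sol_f1_cont : {for t, continuous f1};
  sol_f2_cont : {for t, continuous f2};
  sol_f1 : f1 t ^+ 2 = P.[vx1 (z t)] - coefC F (vx1 (z t)) (vx2 (z t)) / ve2 (z t);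
  sol_f2 : f2 t ^+ 2 = P.[vx2 (z t)] - coefC F (vx1 (z t)) (vx2 (z t)) / ve1 (z t);
  sol_branch : f1 t * f2 t = sg * (coefB F (vx1 (z t)) (vx2 (z t)) / 2);
  sol_integral :
    P.[vx2 (z t)] * ve1 (z t) + P.[vx1 (z t)] * ve2 (z t) =
    coefC F (vx1 (z t)) (vx2 (z t))
    - ve1 (z t) * ve2 (z t) * coefA F (vx1 (z t)) (vx2 (z t))
}.

(* e1 e2 = k^2 is required at one time only: e1 e2 is a first integral. *)
Definition solution_on (R : realType) (F : {poly {poly {poly R[i]}}})
    (P : {poly R[i]}) (sg : R[i]) (m g_r g_g3 : state R[i] -> R[i]) (k : R[i])
    (I : set R) (z : R -> state R[i]) : Prop :=
  (exists f1 f2 : R -> R[i]^o,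
     forall t, I t -> solves_at F P sg m g_r g_g3 z f1 f2 t) /\
  (exists2 t0, I t0 & ve1 (z t0) * ve2 (z t0) = k ^+ 2).

(* s1, s2 are the two roots of F(x1, x2, s) in s; the last two conditions keep
   the square roots of Phi away from zero. *)
Record separation_at (R : realType) (F : {poly {poly {poly R[i]}}})
    (Phi : {poly R[i]}) (z : R -> state R[i]) (s1 s2 : R -> R[i]^o) (t : R) :
    Prop := SeparationAt {
  sep_lead : coefA F (vx1 (z t)) (vx2 (z t)) != 0;
  sep_root1 : F.[(s1 t)%:P%:P].[vx1 (z t), vx2 (z t)] = 0;
  sep_root2 : F.[(s2 t)%:P%:P].[vx1 (z t), vx2 (z t)] = 0;
  sep_neq : s1 t != s2 t;
  sep_cont1 : {for t, continuous s1};
  sep_cont2 : {for t, continuous s2};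
  sep_Phi1 : Phi.[s1 t] != 0;
  sep_Phi2 : Phi.[s2 t] != 0
}.

(* (s1, y1) and (s2, y2) are points of the curve y^2 = Phi(z) whose image under
   the Abel map moves with velocity (c0, c1). *)
Record abel_linear_at (R : realType) (Phi : {poly R[i]}) (c0 c1 : R[i])
    (s1 s2 y1 y2 : R -> R[i]^o) (t : R) : Prop := AbelLinearAt {
  abel_cont1 : {for t, continuous y1};
  abel_cont2 : {for t, continuous y2};
  abel_curve1 : y1 t ^+ 2 = Phi.[s1 t];
  abel_curve2 : y2 t ^+ 2 = Phi.[s2 t];
  abel_flow : exists d1 d2 : R[i],
    [/\ has_deriv s1 t d1, has_deriv s2 t d2,
        d1 / y1 t + d2 / y2 t = c0 &
        s1 t * d1 / y1 t + s2 t * d2 / y2 t = c1]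
}.

(* sol I z means that z is a solution on the time interval I. *)
Definition linearized_on_jacobian (R : realType)
    (F : {poly {poly {poly R[i]}}}) (Phi : {poly R[i]})
    (sol : set R -> (R -> state R[i]) -> Prop) : Prop :=
  exists c0 c1 : R[i], (c0, c1) != (0, 0) /\
    forall (I : set R) (z : R -> state R[i]) (s1 s2 : R -> R[i]^o),
      open I -> is_interval I -> sol I z ->
      (forall t, I t -> separation_at F Phi z s1 s2 t) ->
      exists y1 y2 : R -> R[i]^o,
        forall t, I t -> abel_linear_at Phi c0 c1 s1 s2 y1 y2 t.

(* Main.v *)
Require Import Defs.
From mathcomp Require Import all_boot all_order all_algebra complex polyXY.
From mathcomp Require Import all_classical all_reals all_analysis.
From mathcomp Require Import ring.
Import Order.TTheory GRing.Theory Num.Theory.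
Import numFieldNormedType.Exports.

Set Implicit Arguments.
Unset Strict Implicit.
Unset Printing Implicit Defensive.

Local Open Scope classical_set_scope.
Local Open Scope ring_scope.

(** F is quadratic in each variable, so on F = 0 the squares of its partial
    derivatives are the discriminants: F_{x1}^2 = 4 P(x2) J(s),
    F_{x2}^2 = 4 P(x1) J(s), F_s^2 = 4 P(x1) P(x2).  Hence F divides
    (F_{x1} F_{x2} - 2 J F_s) (F_{x1} F_{x2} + 2 J F_s), and irreducibility gives
    one global sign eps with F_{x1} F_{x2} = 2 eps J F_s on F = 0; the branch
    sign of f1 f2 has to be sg = - eps.
    Let s, s' be the roots.  Differentiating F(x1, x2, s) = 0 gives
    A (s - s') ds/dt = (i / 2) U with U = F_{x1}(s) f1 - F_{x2}(s) f2, and the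
    integral yields k^2 U^2 = 4 J(s) A^2 s'^2 (k^2 - s^2).  So y = i k U / (2 A s')
    satisfies y^2 = Phi(s) and k (s - s') ds/dt = s' y; adding the equations for
    the two roots gives c0 = - 1 / k and c1 = 0.
    The quotient U / (A s') breaks down where s' = 0.  With
    V = F_{x1}(s) f1 + F_{x2}(s) f2 one has
    U V = A s' W for W = 4 J(s) s (P(x1) / e1 - P(x2) / e2),
    and k^2 V^2 = 4 J(s) A^2 s^2 (k^2 - s'^2), so V does not vanish there and W / V
    replaces U / (A s'); this is why y can be chosen continuous. *)

(** * F as a quadratic in each of its three variables *)

Definition eval3 (K : fieldType) (F : {poly {poly {poly K}}}) (x1 x2 s : K) : K :=
  F.[s%:P%:P].[x1, x2].

Definition quad (K : fieldType) (g : {poly {poly {poly K}}}) (y z x : K) : K :=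
  (g`_2).[y, z] * x ^+ 2 + (g`_1).[y, z] * x + (g`_0).[y, z].

(* [slope g y z x x] is the derivative of [quad g y z] at [x]. *)
Definition slope (K : fieldType) (g : {poly {poly {poly K}}}) (y z x x' : K) : K :=
  (g`_2).[y, z] * (x + x') + (g`_1).[y, z].

Lemma quadB (K : fieldType) (g : {poly {poly {poly K}}}) (y z x x' : K) :
  quad g y z x - quad g y z x' = (x - x') * slope g y z x x'.
Proof. rewrite /quad /slope; ring. Qed.

Lemma horner_quad (K : fieldType) (g : {poly {poly {poly K}}}) (x y z : K) :
  size g = 3%N -> g.[x%:P%:P].[y, z] = quad g y z x.
Proof.
move=> sg; rewrite (horner_coef g) sg !big_ord_recl big_ord0 /= /bump /= /quad.
rewrite !hornerE /=; ring.
Qed.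

Lemma eval3_x1 (K : fieldType) (F : {poly {poly {poly K}}}) (x1 x2 s : K) :
  eval3 F x1 x2 s = (as_poly_x1 F).[x1%:P%:P].[s, x2].
Proof.
have := @horner2_swapXY _ F x1%:P s%:P.
rewrite /eval3 /as_poly_x1 => ->; reflexivity.
Qed.

Lemma eval3_x2 (K : fieldType) (F : {poly {poly {poly K}}}) (x1 x2 s : K) :
  eval3 F x1 x2 s = (as_poly_x2 F).[x2%:P%:P].[s, x1].
Proof.
have := @horner2_swapXY _ (map_poly (@swapXY K) F) x2%:P s%:P.
rewrite /eval3 /as_poly_x2 => ->.
(* A constant is its own image under [swapXY], so evaluation at it commutes with the coefficientwise
   swap. *)
rewrite -[in RHS](_ : swapXY s%:P%:P = s%:P%:P); last by rewrite swapXY_polyC map_polyC.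
rewrite horner_map /= horner2_swapXY; reflexivity.
Qed.

(** Completing the square: $(2ax+b)^2=(b^2-4ac)+4a(ax^2+bx+c)$. *)
Lemma sqr_slope (K : fieldType) (g : {poly {poly {poly K}}}) (y z x : K) :
  slope g y z x x ^+ 2 = (disc2 g).[y, z] + 4 * (g`_2).[y, z] * quad g y z x.
Proof.
rewrite /slope /quad /disc2 !hornerE /=; ring.
Qed.

Lemma slope_coef (K : fieldType) (F : {poly {poly {poly K}}}) (x1 x2 s s' : K) :
  slope F x1 x2 s s' = coefA F x1 x2 * (s + s') + Defs.coefB F x1 x2.
Proof. by []. Qed.

(** * Vanishing, divisibility and evaluation in three variables *)

(** In characteristic zero the images of $0,1,2,\dots$ under [f] are distinct; [size p] of them are
    more roots than a nonzero [p] can have. *)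
Lemma poly_eq0_inj (K : numFieldType) (D : idomainType) (f : K -> D) (p : {poly D}) :
  injective f -> (forall x, p.[f x] = 0) -> p = 0.
Proof.
move=> finj pf; apply/eqP/negP=> /negP p0.
pose rs := [seq f n%:R | n <- iota 0 (size p)].
have := @max_poly_roots _ p rs p0.
rewrite /rs size_map size_iota ltnn => H; have : false; last by [].
apply: H; first by apply/allP=> _ /mapP[n _ ->]; apply/rootP/pf.
rewrite map_inj_uniq ?iota_uniq // => m n /finj/eqP.
by rewrite eqr_nat => /eqP.
Qed.

Lemma poly3_eq0 (K : numFieldType) (p : {poly {poly {poly K}}}) :
  (forall x1 x2 s, eval3 p x1 x2 s = 0) -> p = 0.
Proof.
move=> H; apply: (@poly_eq0_inj K _ (fun s => s%:P%:P)).
  by move=> a b /polyC_inj/polyC_inj.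
move=> s; apply: (@poly_eq0_inj K _ (fun s => s%:P)); first exact: polyC_inj.
by move=> x1; apply: (@poly_eq0_inj K _ id) => // x2; apply: H.
Qed.

(** Over a domain [%|] is pseudo-divisibility, that is, divisibility over the fraction field, where
    gcds make an irreducible polynomial prime. *)
Lemma irred_dvdpM (D : idomainType) (p q r : {poly D}) :
  irreducible_poly p -> p %| q * r -> (p %| q) || (p %| r).
Proof.
move=> irr pqr; case: (boolP (coprimep p q)) => [cp|ncp].
  by rewrite (Gauss_dvdpr _ cp) in pqr; rewrite pqr orbT.
have /irr : size (gcdp p q) != 1%N by [].
by move=> /(_ (dvdp_gcdl _ _)) /eqp_dvdl <-; rewrite dvdp_gcdr.
Qed.

(** Pseudo-division multiplies [q] by a power of [lead_coef p], so zeros of [p] pass to [q] where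
    that coefficient does not vanish. *)
Lemma dvdp_eval3 (K : fieldType) (p q : {poly {poly {poly K}}}) (x1 x2 s : K) :
  p %| q -> (lead_coef p).[x1, x2] != 0 -> eval3 p x1 x2 s = 0 -> eval3 q x1 x2 s = 0.
Proof.
rewrite Pdiv.Idomain.dvdp_eq => /eqP /(congr1 (fun r => eval3 r x1 x2 s)).
rewrite /eval3 hornerZ !hornerM !horner_exp => e l0 p0; move: e; rewrite p0 mulr0.
by move/eqP; rewrite mulf_eq0 expf_eq0 (negPf l0) andbF => /eqP.
Qed.

Lemma eval3D (K : fieldType) (p q : {poly {poly {poly K}}}) (x1 x2 s : K) :
  eval3 (p + q) x1 x2 s = eval3 p x1 x2 s + eval3 q x1 x2 s.
Proof. by rewrite /eval3 !hornerD. Qed.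

Lemma eval3N (K : fieldType) (p : {poly {poly {poly K}}}) (x1 x2 s : K) :
  eval3 (- p) x1 x2 s = - eval3 p x1 x2 s.
Proof. by rewrite /eval3 !hornerN. Qed.

Lemma eval3M (K : fieldType) (p q : {poly {poly {poly K}}}) (x1 x2 s : K) :
  eval3 (p * q) x1 x2 s = eval3 p x1 x2 s * eval3 q x1 x2 s.
Proof. by rewrite /eval3 !hornerM. Qed.

Lemma eval3C (K : fieldType) (p : {poly {poly K}}) (x1 x2 s : K) :
  eval3 p%:P x1 x2 s = p.[x1, x2].
Proof. by rewrite /eval3 hornerC. Qed.

Lemma eval3X (K : fieldType) (x1 x2 s : K) : eval3 'X x1 x2 s = s.
Proof. by rewrite /eval3 !hornerE. Qed.

(** The coefficients of F in $x_1$ lie in K[x2][s], those in $x_2$ in K[x1][s]. This lift and the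
    next embed them in K[x2][x1][s] as polynomials free of $x_1$ and of $x_2$ respectively. *)
Lemma eval3_lift1 (K : fieldType) (g : {poly {poly K}}) (x1 x2 s : K) :
  eval3 (map_poly polyC g) x1 x2 s = g.[s, x2].
Proof. by rewrite /eval3 horner_map hornerC. Qed.

Lemma eval3_lift2 (K : fieldType) (g : {poly {poly K}}) (x1 x2 s : K) :
  eval3 (map_poly (map_poly polyC) g) x1 x2 s = g.[s, x1].
Proof.
have e := horner_map (map_poly (@polyC K)) g s%:P.
rewrite /= map_polyC /= in e.
rewrite /eval3 e.
by rewrite horner_map /= hornerC.
Qed.

(** * Squares of the partial derivatives, and exact increments of F *)

Lemma horner2_disc (K : fieldType) (P J : {poly K}) (y z : K) :
  (4 * (P%:P * map_poly polyC J)).[y, z] = 4 * (P.[z] * J.[y]).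
Proof. by rewrite !hornerE /= horner_map /= hornerC; ring. Qed.

(** The multiple of F is kept: the cofactor in the divisibility by F is read off from these
    remainders. *)
Lemma sqr_slope_x1 (K : fieldType) (F : {poly {poly {poly K}}}) (P J : {poly K})
    (x1 x2 s : K) :
  discriminantly_separable F P J ->
  slope (as_poly_x1 F) s x2 x1 x1 ^+ 2 =
  4 * (P.[x2] * J.[s]) + 4 * ((as_poly_x1 F)`_2).[s, x2] * eval3 F x1 x2 s.
Proof.
move=> ds; rewrite sqr_slope (ds_disc_x1 ds) horner2_disc eval3_x1.
by rewrite -horner_quad // (ds_deg_x1 ds).
Qed.

Lemma sqr_slope_x2 (K : fieldType) (F : {poly {poly {poly K}}}) (P J : {poly K})
    (x1 x2 s : K) :
  discriminantly_separable F P J ->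
  slope (as_poly_x2 F) s x1 x2 x2 ^+ 2 =
  4 * (P.[x1] * J.[s]) + 4 * ((as_poly_x2 F)`_2).[s, x1] * eval3 F x1 x2 s.
Proof.
move=> ds; rewrite sqr_slope (ds_disc_x2 ds) horner2_disc eval3_x2.
by rewrite -horner_quad // (ds_deg_x2 ds).
Qed.

Lemma disc_s (K : fieldType) (F : {poly {poly {poly K}}}) (P J : {poly K})
    (x1 x2 : K) :
  discriminantly_separable F P J ->
  Defs.coefB F x1 x2 ^+ 2 - 4 * (coefA F x1 x2 * Defs.coefC F x1 x2) =
  4 * (P.[x1] * P.[x2]).
Proof.
move=> ds; have := congr1 (fun p : {poly {poly K}} => p.[x1, x2]) (ds_disc_s ds).
rewrite [map_poly _ P * _]mulrC horner2_disc (mulrC P.[x1]) => <-.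
by rewrite /disc2 !hornerE /= /coefA /Defs.coefB /Defs.coefC; ring.
Qed.

Lemma sqr_slope_s (K : fieldType) (F : {poly {poly {poly K}}}) (P J : {poly K})
    (x1 x2 s : K) :
  discriminantly_separable F P J ->
  slope F x1 x2 s s ^+ 2 =
  4 * (P.[x1] * P.[x2]) + 4 * coefA F x1 x2 * eval3 F x1 x2 s.
Proof.
move=> ds; rewrite sqr_slope (ds_disc_s ds) [map_poly _ P * _]mulrC horner2_disc.
by rewrite (mulrC P.[x1]) /eval3 horner_quad // (ds_deg_s ds).
Qed.

Lemma eval3_quad_x1 (K : fieldType) (F : {poly {poly {poly K}}}) (x1 x2 s : K) :
  size (as_poly_x1 F) = 3%N -> eval3 F x1 x2 s = quad (as_poly_x1 F) s x2 x1.
Proof. by move=> sF; rewrite eval3_x1 horner_quad. Qed.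

Lemma eval3_quad_x2 (K : fieldType) (F : {poly {poly {poly K}}}) (x1 x2 s : K) :
  size (as_poly_x2 F) = 3%N -> eval3 F x1 x2 s = quad (as_poly_x2 F) s x1 x2.
Proof. by move=> sF; rewrite eval3_x2 horner_quad. Qed.

Lemma eval3_quad_s (K : fieldType) (F : {poly {poly {poly K}}}) (x1 x2 s : K) :
  size F = 3%N -> eval3 F x1 x2 s = quad F x1 x2 s.
Proof. exact: horner_quad. Qed.

(** Telescoping: first $x_1$ moves, then $x_2$, then $s$. Since F is quadratic in each variable the
    increments are exact, with no remainder term. *)
Lemma eval3B (K : fieldType) (F : {poly {poly {poly K}}}) (x1 x2 s x1' x2' s' : K) :
  size F = 3%N -> size (as_poly_x1 F) = 3%N -> size (as_poly_x2 F) = 3%N ->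
  eval3 F x1' x2' s' - eval3 F x1 x2 s =
  (x1' - x1) * slope (as_poly_x1 F) s' x2' x1' x1 +
  (x2' - x2) * slope (as_poly_x2 F) s' x1 x2' x2 +
  (s' - s) * slope F x1 x2 s' s.
Proof.
move=> sF sF1 sF2; rewrite -!quadB.
rewrite -!(eval3_quad_x1 _ _ _ sF1) -!(eval3_quad_x2 _ _ _ sF2) -!(eval3_quad_s _ _ _ sF).
ring.
Qed.

(** * The global sign relating the three partial derivatives *)

Lemma slope_mul (K : numFieldType) (F : {poly {poly {poly K}}}) (P J : {poly K}) :
  discriminantly_separable F P J -> irreducible_poly F ->
  exists2 eps : K, eps ^+ 2 = 1 &
    forall x1 x2 s, coefA F x1 x2 != 0 -> eval3 F x1 x2 s = 0 ->
      slope (as_poly_x1 F) s x2 x1 x1 * slope (as_poly_x2 F) s x1 x2 x2 =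
      eps * (2 * J.[s] * slope F x1 x2 s s).
Proof.
move=> ds irr.
pose a1 := as_poly_x1 F; pose a2 := as_poly_x2 F.
(* The relation is lifted to polynomials: [G] is $F_{x_1}F_{x_2}$ and [H] is $2JF_s$. *)
pose X1 : {poly {poly {poly K}}} := 'X%:P.
pose X2 : {poly {poly {poly K}}} := 'X%:P%:P.
pose l1 (g : {poly {poly K}}) := map_poly polyC g.
pose l2 (g : {poly {poly K}}) := map_poly (map_poly polyC) g.
pose G := (l1 a1`_2 * (X1 + X1) + l1 a1`_1) * (l2 a2`_2 * (X2 + X2) + l2 a2`_1).
pose J3 := l1 (map_poly polyC J).
pose H := (J3 + J3) * ((F`_2)%:P * ('X + 'X) + (F`_1)%:P).
have evX1 x1 x2 s : eval3 X1 x1 x2 s = x1 by rewrite eval3C !hornerE.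
have evX2 x1 x2 s : eval3 X2 x1 x2 s = x2 by rewrite eval3C !hornerE.
have evG x1 x2 s : eval3 G x1 x2 s = slope a1 s x2 x1 x1 * slope a2 s x1 x2 x2.
  by rewrite eval3M !eval3D !eval3M !eval3D !eval3_lift1 !eval3_lift2 evX1 evX2.
have evJ x1 x2 s : eval3 J3 x1 x2 s = J.[s].
  by rewrite eval3_lift1 horner_map hornerC.
have evH x1 x2 s : eval3 H x1 x2 s = 2 * J.[s] * slope F x1 x2 s s.
  rewrite eval3M !eval3D !eval3M !eval3D !eval3C evJ eval3X /slope; ring.
pose P1 := l2 (P%:P); pose P2 := l1 (P%:P).
have evP1 x1 x2 s : eval3 P1 x1 x2 s = P.[x1] by rewrite eval3_lift2 hornerC.
have evP2 x1 x2 s : eval3 P2 x1 x2 s = P.[x2] by rewrite eval3_lift1 hornerC.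
pose four : {poly {poly {poly K}}} := 4%:P%:P%:P.
have ev4 x1 x2 s : eval3 four x1 x2 s = 4 by rewrite /four !eval3C !hornerE.
(* [M] comes from expanding $G^2-H^2$ with the three squared derivatives: the terms
   $16P(x_1)P(x_2)J^2$ cancel and every other term contains F. *)
pose M := four * (four * P2 * J3 * l2 a2`_2 + four * P1 * J3 * l1 a1`_2
  + four * l1 a1`_2 * l2 a2`_2 * F - four * J3 * J3 * (F`_2)%:P).
have FM : (G - H) * (G + H) = F * M.
  apply/eqP; rewrite -subr_eq0; apply/eqP; apply: poly3_eq0 => x1 x2 s.
  rewrite eval3D eval3N !eval3M !eval3D !eval3N evG evH.
  have -> (a b : K) : (a - b) * (a + b) = a ^+ 2 - b ^+ 2 by ring.
  rewrite !exprMn (sqr_slope_x1 _ _ _ ds) (sqr_slope_x2 _ _ _ ds).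
  rewrite (sqr_slope_s _ _ _ ds) !eval3M evP1 evP2 evJ ev4 !eval3_lift1 !eval3_lift2 eval3C.
  rewrite /coefA -/a1 -/a2; ring.
have /(irred_dvdpM irr) : F %| (G - H) * (G + H) by rewrite FM dvdp_mulr.
have lF : lead_coef F = F`_2 by rewrite lead_coefE (ds_deg_s ds).
case/orP => dv; [exists 1|exists (-1)]; rewrite ?expr1n ?sqrrN ?expr1n //.
  move=> x1 x2 s A0 F0; rewrite mul1r; apply/eqP; rewrite -subr_eq0 -evG -evH.
  by rewrite -eval3N -eval3D; apply/eqP/(dvdp_eval3 dv) => //; rewrite lF.
move=> x1 x2 s A0 F0; rewrite mulN1r; apply/eqP; rewrite -addr_eq0 -evG -evH.
by rewrite -eval3D; apply/eqP/(dvdp_eval3 dv) => //; rewrite lF.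
Qed.

(** * Pointwise algebra of the radicals *)

(** [g1] and [g2] stand for $F_{x_1}$ and $F_{x_2}$ at the root [s], and [p1], [p2] for $P(x_1)$,
    $P(x_2)$. The squares of $g_1f_1\pm g_2f_2$ differ only in the sign of the cross term, which the
    branch condition determines. *)
Lemma kotter_sqr (K : fieldType) (A B C J p1 p2 e1 e2 f1 f2 k s s' g1 g2 eps : K) :
  e1 != 0 -> e2 != 0 -> e1 * e2 = k ^+ 2 ->
  f1 ^+ 2 = p1 - C / e2 -> f2 ^+ 2 = p2 - C / e1 -> f1 * f2 = - eps * (B / 2) ->
  p2 * e1 + p1 * e2 = C - e1 * e2 * A ->
  B = - (A * (s + s')) -> C = A * (s * s') -> B ^+ 2 - 4 * (A * C) = 4 * (p1 * p2) ->
  g1 ^+ 2 = 4 * (p2 * J) -> g2 ^+ 2 = 4 * (p1 * J) ->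
  g1 * g2 = eps * (2 * J * (A * (s + s) + B)) -> eps ^+ 2 = 1 -> 2 != 0 :> K ->
  [/\ (g1 * f1 - g2 * f2) * (g1 * f1 + g2 * f2) =
        A * s' * (4 * J * s * (p1 / e1 - p2 / e2)),
      k ^+ 2 * (g1 * f1 - g2 * f2) ^+ 2 = 4 * J * (A * s') ^+ 2 * (k ^+ 2 - s ^+ 2),
      k ^+ 2 * (g1 * f1 + g2 * f2) ^+ 2 = 4 * J * (A * s) ^+ 2 * (k ^+ 2 - s' ^+ 2) &
      k ^+ 4 * (p1 / e1 - p2 / e2) ^+ 2 =
        A ^+ 2 * (k ^+ 2 - s ^+ 2) * (k ^+ 2 - s' ^+ 2)].
Proof.
move=> e10 e20 ek hf1 hf2 hff hint hB hC hd hg1 hg2 hgg he two0.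
have sqf1 : k ^+ 2 * f1 ^+ 2 = k ^+ 2 * p1 - C * e1 by rewrite hf1 -ek; field.
have sqf2 : k ^+ 2 * f2 ^+ 2 = k ^+ 2 * p2 - C * e2 by rewrite hf2 -ek; field.
have hp : 2 * (p1 * p2) = A ^+ 2 * (s - s') ^+ 2 / 2.
  apply: (mulfI two0); have -> : 2 * (2 * (p1 * p2)) = 4 * (p1 * p2) by ring.
  by rewrite -hd hB hC; field.
(* The branch sign $-\varepsilon$ meets the sign $\varepsilon$ of [hgg], so the product no longer
   depends on $\varepsilon$. *)
have hcross : (g1 * g2) * (f1 * f2) = J * A ^+ 2 * (s ^+ 2 - s' ^+ 2).
  have -> : (g1 * g2) * (f1 * f2) =
    - eps ^+ 2 * (2 * J * (A * (s + s) + B)) * (B / 2) by rewrite hgg hff; ring.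
  by rewrite he hB; field.
(* The integral replaces $p_2e_1+p_1e_2$ by $C-k^2A$. *)
have hsum : k ^+ 2 * (p2 * f1 ^+ 2 + p1 * f2 ^+ 2) =
    k ^+ 2 * (2 * (p1 * p2)) - C * (C - k ^+ 2 * A).
  have -> : k ^+ 2 * (p2 * f1 ^+ 2 + p1 * f2 ^+ 2) =
    p2 * (k ^+ 2 * f1 ^+ 2) + p1 * (k ^+ 2 * f2 ^+ 2) by ring.
  by rewrite sqf1 sqf2 -ek -hint; ring.
(* Both signs at once: $c=-1$ gives the difference and $c=1$ the sum. *)
have hsq (c : K) : c ^+ 2 = 1 -> k ^+ 2 * (g1 * f1 + c * (g2 * f2)) ^+ 2 =
   4 * J * (k ^+ 2 * (2 * (p1 * p2)) - C * (C - k ^+ 2 * A)) +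
   2 * c * k ^+ 2 * (J * A ^+ 2 * (s ^+ 2 - s' ^+ 2)).
  move=> c2; rewrite -hsum -hcross.
  have -> : k ^+ 2 * (g1 * f1 + c * (g2 * f2)) ^+ 2 =
    k ^+ 2 * (g1 ^+ 2 * f1 ^+ 2 + c ^+ 2 * g2 ^+ 2 * f2 ^+ 2) +
    2 * c * k ^+ 2 * (g1 * g2 * (f1 * f2)) by ring.
  by rewrite hg1 hg2 c2; ring.
have k0 : k != 0.
  by have := mulf_neq0 e10 e20; rewrite ek expf_eq0.
split.
- have -> : (g1 * f1 - g2 * f2) * (g1 * f1 + g2 * f2) =
    g1 ^+ 2 * f1 ^+ 2 - g2 ^+ 2 * f2 ^+ 2 by ring.
  by rewrite hg1 hg2 hf1 hf2 hC; field; rewrite ?e10 ?e20.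
- have -> : g1 * f1 - g2 * f2 = g1 * f1 + (-1) * (g2 * f2) by ring.
  by rewrite hsq ?sqrrN ?expr1n // hp hC; field.
- have -> : g1 * f1 + g2 * f2 = g1 * f1 + 1 * (g2 * f2) by ring.
  by rewrite hsq ?expr1n // hp hC; field.
have -> : k ^+ 4 * (p1 / e1 - p2 / e2) ^+ 2 = (k ^+ 2 * (p1 / e1 - p2 / e2)) ^+ 2 by ring.
have -> : k ^+ 2 * (p1 / e1 - p2 / e2) = p1 * e2 - p2 * e1.
  by rewrite -ek; field; rewrite ?e10 ?e20.
(* $(a-b)^2=(a+b)^2-4ab$, with $a+b$ known from the integral and $ab$ from the discriminant. *)
have -> : (p1 * e2 - p2 * e1) ^+ 2 =
  (p2 * e1 + p1 * e2) ^+ 2 - 2 * (2 * (p1 * p2)) * (e1 * e2) by ring.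
by rewrite hint hp ek hC; field.
Qed.

(* The candidates [U / a] and [W / v] for the same function may each be undefined;
   averaging them with the weights [`|a| ^+ 2] and [`|v| ^+ 2] keeps continuity. *)
Definition blend (K : numClosedFieldType) (a U v W : K) : K :=
  (U * a^* + W * v^*) / (a * a^* + v * v^*).

Lemma blend_denom (K : numClosedFieldType) (a v : K) :
  (a != 0) || (v != 0) -> a * a^* + v * v^* != 0.
Proof.
rewrite -!normCK paddr_eq0 ?exprn_ge0 // !expf_eq0 /= !normr_eq0 negb_and.
by case/orP => ->; rewrite ?orbT.
Qed.

(** The hypothesis says that $(U,W)$ is a multiple of the nonzero vector $(a,v)$; [blend] is the
    Hermitian projection coefficient, hence the factor. *)
Lemma blendE (K : numClosedFieldType) (a U v W : K) :
  (a != 0) || (v != 0) -> U * v = a * W ->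
  blend a U v W * a = U /\ blend a U v W * v = W.
Proof.
move=> /blend_denom d0 UW; rewrite /blend.
split; rewrite mulrAC; apply: (mulIf d0); rewrite divfK //.
  have -> : (U * a^* + W * v^*) * a = U * (a * a^*) + (a * W) * v^* by ring.
  by rewrite -UW; ring.
have -> : (U * a^* + W * v^*) * v = (U * v) * a^* + W * (v * v^*) by ring.
by rewrite UW; ring.
Qed.

Lemma blend_sqr (K : numClosedFieldType) (A J k s s' U V D : K) :
  A != 0 -> k != 0 -> s != s' -> J * (s ^+ 2 - k ^+ 2) != 0 ->
  U * V = A * s' * (4 * J * s * D) ->
  k ^+ 2 * U ^+ 2 = 4 * J * (A * s') ^+ 2 * (k ^+ 2 - s ^+ 2) ->
  k ^+ 2 * V ^+ 2 = 4 * J * (A * s) ^+ 2 * (k ^+ 2 - s' ^+ 2) ->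
  k ^+ 4 * D ^+ 2 = A ^+ 2 * (k ^+ 2 - s ^+ 2) * (k ^+ 2 - s' ^+ 2) ->
  let Q := blend (A * s') U V (4 * J * s * D) in
  [/\ (A * s' != 0) || (V != 0), Q * (A * s') = U &
      k ^+ 2 * Q ^+ 2 = 4 * J * (k ^+ 2 - s ^+ 2)].
Proof.
move=> A0 k0 ss JP UV hU hV hD Q.
have J0 : J != 0 by move: JP; rewrite mulf_eq0 negb_or => /andP[].
(* If $s'=0$ and $V=0$, the formula for $V^2$ forces $s=0=s'$, but the roots are distinct. *)
have nz : (A * s' != 0) || (V != 0).
  case: (eqVneq s' 0) => [s'0|s'0]; last by rewrite mulf_neq0.
  rewrite s'0 mulr0 eqxx /=; apply: contraNneq ss => V0.
  have : 4 * J * (A * s) ^+ 2 * k ^+ 2 = 0.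
    by move: hV; rewrite V0 s'0 expr0n /= mulr0 subr0.
  move/eqP; rewrite mulf_eq0 (negPf (expf_neq0 2 k0)) orbF mulf_eq0.
  rewrite (negPf (mulf_neq0 _ J0)) ?pnatr_eq0 //= expf_eq0 /= mulf_eq0 (negPf A0) /=.
  by rewrite s'0.
have := blendE nz UV; rewrite -/Q => -[Qa QV]; split => //.
(* Where $s'=0$ the square is recovered from $QV=W$ and the formula for $D^2$, elsewhere from
   $Q\,As'=U$. *)
case: (eqVneq s' 0) => [s'0|s'0].
  have V0 : V != 0 by move: nz; rewrite s'0 mulr0 eqxx.
  apply: (mulIf (expf_neq0 2 V0)).
  have -> : k ^+ 2 * Q ^+ 2 * V ^+ 2 = k ^+ 2 * (Q * V) ^+ 2 by ring.
  rewrite QV.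
  apply: (mulfI (expf_neq0 2 k0)).
  have -> (a b c d : K) : a ^+ 2 * (a ^+ 2 * (4 * b * c * d) ^+ 2) =
     16 * b ^+ 2 * c ^+ 2 * (a ^+ 4 * d ^+ 2) by ring.
  have -> (a b c : K) : k ^+ 2 * (a * b * c ^+ 2) = a * b * (k ^+ 2 * c ^+ 2) by ring.
  by rewrite hD hV; ring.
have a0 : A * s' != 0 by rewrite mulf_neq0.
apply: (mulIf (expf_neq0 2 a0)).
have -> : k ^+ 2 * Q ^+ 2 * (A * s') ^+ 2 = k ^+ 2 * (Q * (A * s')) ^+ 2 by ring.
by rewrite Qa hU; ring.
Qed.

(* Stated at the type [K^o] because unification with [cvgD], [cvgM], ... at
   [K = R[i]] is prohibitively slow. *)
Lemma cvgDo (K : numFieldType) (T : Type) (G : set_system T) {FG : Filter G}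
    (f g : T -> K^o) (a b : K^o) :
  f @ G --> a -> g @ G --> b -> (fun u => f u + g u : K^o) @ G --> (a + b : K^o).
Proof. by move=> fa gb; apply: cvgD. Qed.

Lemma cvgNo (K : numFieldType) (T : Type) (G : set_system T) {FG : Filter G}
    (f : T -> K^o) (a : K^o) :
  f @ G --> a -> (fun u => - f u : K^o) @ G --> (- a : K^o).
Proof. by move=> fa; apply: cvgN. Qed.

Lemma cvgMo (K : numFieldType) (T : Type) (G : set_system T) {FG : Filter G}
    (f g : T -> K^o) (a b : K^o) :
  f @ G --> a -> g @ G --> b -> (fun u => f u * g u : K^o) @ G --> (a * b : K^o).
Proof. by move=> fa gb; apply: cvgM. Qed.

Lemma cvgVo (K : numFieldType) (T : Type) (G : set_system T) {FG : Filter G}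
    (f : T -> K^o) (a : K^o) :
  a != 0 -> f @ G --> a -> (fun u => (f u)^-1 : K^o) @ G --> (a^-1 : K^o).
Proof. by move=> a0 fa; apply: cvgV. Qed.

Lemma cvg_csto (K : numFieldType) (T : Type) (G : set_system T) {FG : Filter G}
    (a : K^o) : (fun=> a) @ G --> a.
Proof. exact: cvg_cst. Qed.
Arguments cvg_csto {K T G FG} a.

Lemma cvg_eq_near (T U : Type) (G : set_system T) {FG : Filter G} (H : set_system U)
    (f g : T -> U) :
  (\forall u \near G, f u = g u) -> f @ G --> H -> g @ G --> H.
Proof. by move=> fg; apply: cvg_trans; apply: near_eq_cvg. Qed.

(** * Continuity of polynomial expressions, real and imaginary parts, and conjugation *)

Lemma cvg_horner (K : numFieldType) (T : Type) (G : set_system T) {FG : Filter G}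
    (p : {poly K}) (f : T -> K^o) (a : K^o) :
  f @ G --> a -> (fun u => p.[f u] : K^o) @ G --> (p.[a] : K^o).
Proof.
move=> fa; elim/poly_ind: p => [|p c IH].
  by under eq_fun do rewrite horner0; rewrite horner0; exact: cvg_cst.
under eq_fun do rewrite hornerMXaddC.
by rewrite hornerMXaddC; apply: cvgD; [exact: cvgM | exact: cvg_cst].
Qed.
Arguments cvg_horner {K T G FG} p {f a}.

Lemma cvg_horner2 (K : numFieldType) (T : Type) (G : set_system T) {FG : Filter G}
    (p : {poly {poly K}}) (f g : T -> K^o) (a b : K^o) :
  f @ G --> a -> g @ G --> b ->
  (fun u => p.[f u, g u] : K^o) @ G --> (p.[a, b] : K^o).
Proof.
move=> fa gb; elim/poly_ind: p => [|p q IH].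
  by under eq_fun do rewrite !horner0; rewrite !horner0; exact: cvg_cst.
under eq_fun do rewrite hornerMXaddC hornerD hornerM hornerC.
rewrite hornerMXaddC hornerD hornerM hornerC.
by apply: cvgD; [exact: cvgM | exact: cvg_horner].
Qed.
Arguments cvg_horner2 {K T G FG} p {f g a b}.

Lemma cvg_slope (K : numFieldType) (T : Type) (G : set_system T) {FG : Filter G}
    (g : {poly {poly {poly K}}}) (y z x x' : T -> K^o) (b c a a' : K^o) :
  y @ G --> b -> z @ G --> c -> x @ G --> a -> x' @ G --> a' ->
  (fun u => slope g (y u) (z u) (x u) (x' u) : K^o) @ G --> (slope g b c a a' : K^o).
Proof.
move=> yb zc xa xa'; rewrite /slope; apply: cvgD; last exact: cvg_horner2.
by apply: cvgM; [exact: cvg_horner2 | exact: cvgD].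
Qed.

Arguments cvg_slope {K T G FG} g {y z x x' b c a a'}.

Lemma cvg_real_complex (R : realType) :
  ((h%:C)%C : R[i]^o) @[h --> (0 : R)] --> (0 : R[i]^o).
Proof.
apply/cvgrPdist_lt => e e0.
have eE : e = (complex.Re e)%:C%C by rewrite RRe_real // gtr0_real.
have re0 : 0 < complex.Re e by rewrite -ltcR -eE.
apply/nbhs_normP; exists (complex.Re e) => // h /=.
by rewrite !sub0r !normrN normc_def /= expr0n addr0 sqrtr_sqr eE ltcR.
Qed.

Lemma continuous_Re (R : realType) : continuous (@complex.Re R : R[i]^o -> R^o).
Proof.
move=> x; apply/(@cvgrPdist_lt R R^o R[i]^o (nbhs (x : R[i]^o)) _) => e e0; apply/(@nbhs_normP R[i] R[i]^o).
exists (e%:C)%C => [|y /= xy]; first by rewrite /= ltcR.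
by rewrite -raddfB -ltcR (le_lt_trans (normc_ge_Re _)).
Qed.

Lemma continuous_conj (K : numClosedFieldType) :
  continuous (@Num.conj_op K : K^o -> K^o).
Proof.
move=> x; apply/(@cvgrPdist_lt K K^o K^o (nbhs (x : K^o)) _) => e e0.
by apply/(@nbhs_normP K K^o); exists e => // y /= xy; rewrite -rmorphB norm_conjC.
Qed.

Lemma continuous_Im (R : realType) : continuous (@complex.Im R : R[i]^o -> R^o).
Proof.
move=> x; apply/(@cvgrPdist_lt R R^o R[i]^o (nbhs (x : R[i]^o)) _) => e e0.
apply/(@nbhs_normP R[i] R[i]^o).
exists (e%:C)%C => [|y /= xy]; first by rewrite /= ltcR.
rewrite -raddfB -ltcR (le_lt_trans _ xy) //.
(* $|\mathrm{Im}\,w|=|\mathrm{Re}(iw)|\le|w|$. *)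
rewrite -normrN -ReiNIm (le_trans (normc_ge_Re _)) // normrM.
by rewrite [`|'i%C|]normc_def /= expr0n expr1n add0r sqrtr1 mulr1.
Qed.

(** * Derivatives of complex-valued functions of real time *)

Lemma cvg_shift_dnbhs (R : realType) (T : topologicalType) (f : R -> T) (t : R) (l : T) :
  f @ t --> l -> f (t + h) @[h --> (0 : R)^'] --> l.
Proof.
move=> fl; apply: cvg_comp fl; apply: cvg_within_filter.
have : (fun h : R => t + h) @ (0 : R) --> (t + 0 : R).
  exact: (@cvgD R R^o R (nbhs (0 : R)) _ (cst t) id t 0 (@cvg_cst _ _ _ _ _) (@cvg_id _ _)).
by rewrite addr0.
Qed.

Lemma has_deriv_continuous (R : realType) (f : R -> R[i]^o) (t : R) (v : R[i]) :
  has_deriv f t v -> {for t, continuous f}.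
Proof.
move=> fv.
have H : (fun h => f (t + h)) @ (0 : R)^' --> (f (t + 0) : R[i]^o).
  rewrite addr0.
  have h0 : (fun h : R => (h%:C)%C : R[i]^o) @ (0 : R)^' --> (0 : R[i]^o).
    by apply: cvg_within_filter; exact: cvg_real_complex.
  pose proof (cvgDo (cvgMo h0 fv) (cvg_csto (f t))) as L.
  rewrite mul0r add0r in L; refine (cvg_eq_near _ L).
  near=> h; rewrite mulrA divff ?mul1r ?subrK //.
  by rewrite eq_complex /= eqxx andbT; near: h; exact: nbhs_dnbhs_neq.
have {}H : {for 0, continuous (fun h : R => f (t + h))} by apply/continuous_withinNx.
have -> : f = (fun h : R => f (t + h)) \o (fun u => u - t).
  by apply/funext => u /=; rewrite addrC subrK.
apply: continuous_comp; last by rewrite subrr.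
exact: (@cvgB R R^o R (nbhs t) _ id (cst t) t t (@cvg_id _ _) (@cvg_cst _ _ _ _ _)).
Unshelve. all: by end_near. Qed.

Lemma has_derivM (R : realType) (f g : R -> R[i]^o) (t : R) (v w : R[i]) :
  has_deriv f t v -> has_deriv g t w ->
  has_deriv (fun u => f u * g u) t (v * g t + f t * w).
Proof.
move=> fv gw.
have gt := cvg_shift_dnbhs (has_deriv_continuous gw).
pose proof (cvgDo (cvgMo fv gt) (cvgMo (cvg_csto (f t)) gw)) as L.
rewrite /has_deriv; refine (cvg_eq_near _ L); near=> h => /=.
ring.
Unshelve. all: by end_near. Qed.

Lemma has_derivZ (R : realType) (f : R -> R[i]^o) (t : R) (c v : R[i]) :
  has_deriv f t v -> has_deriv (fun u => c * f u) t (c * v).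
Proof.
move=> fv; pose proof (cvgMo (cvg_csto (c : R[i]^o)) fv) as L.
rewrite /has_deriv; refine (cvg_eq_near _ L); near=> h => /=.
ring.
Unshelve. all: by end_near. Qed.

(** A real-linear [p] covers the real and the imaginary part together and brings the problem to real
    analysis. *)
Lemma has_deriv_proj (R : realType) (p : {additive R[i] -> R}) (f : R -> R[i]^o) (t : R) :
  continuous (p : R[i]^o -> R^o) -> (forall (a : R) x, p ((a%:C)%C * x) = a * p x) ->
  has_deriv f t 0 -> is_derive t 1 (p \o f : R^o -> R^o) 0.
Proof.
move=> pc pZ f0.
have H : h^-1 *: ((p \o f) (h *: (1 : R^o) + t) - (p \o f) t) @[h --> (0 : R)^'] --> (0 : R^o).
  have L : p ((h%:C)%C^-1 * (f (t + h) - f t)) @[h --> (0 : R)^'] --> (0 : R^o).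
    have := pc 0; rewrite /continuous_at raddf0 => p0.
    exact: (@cvg_comp _ _ _ _ (p : R[i]^o -> R^o) _ _ _ f0 p0).
  refine (cvg_eq_near _ L); near=> h => /=.
  by rewrite -fmorphV pZ raddfB [h *: _]mulr1 (addrC h).
apply: DeriveDef; first by apply/cvg_ex; exists 0.
exact: cvg_lim H.
Unshelve. all: by end_near. Qed.

(** The mean value theorem fails for complex values, so it is applied to the real and imaginary
    parts. This serves to propagate $e_1e_2=k^2$ from one time to the whole interval. *)
Lemma has_deriv0_cst (R : realType) (f : R -> R[i]^o) (I : set R) (a b : R) :
  is_interval I -> (forall t, I t -> has_deriv f t 0) -> I a -> I b -> f a = f b.
Proof.
move=> Iitv f0.
suff H x y : x <= y -> I x -> I y -> f x = f y.
  by case: (leP a b) => [ab|/ltW ba] Ia Ib; [|apply/esym]; apply: H.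
move=> xy Ix Iy.
have Ixy t : t \in `[x, y] -> I t.
  by rewrite in_itv /= => /andP[xt ty]; apply: (Iitv x y) => //; rewrite xt.
have K (p : {additive R[i] -> R}) : continuous (p : R[i]^o -> R^o) ->
    (forall (a : R) x, p ((a%:C)%C * x) = a * p x) -> p (f x) = p (f y).
  move=> pc pZ.
  have := @MVT_segment R (p \o f) (fun=> 0) x y xy.
  case.
  - move=> t txy; apply: has_deriv_proj => //.
    by apply: f0; apply: Ixy; apply: subset_itv_oo_cc.
  - apply: continuous_in_subspaceT => t; rewrite inE => /= txy.
    apply: (@continuous_comp _ _ _ f (p : R[i]^o -> R^o)); last exact: pc.
    by apply: has_deriv_continuous; apply: f0; apply: Ixy.
  - by move=> c _; rewrite /= mul0r => /subr0_eq.
apply/eqP; rewrite eq_complex; apply/andP; split; apply/eqP.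
  apply: (K (@complex.Re R)); first exact: continuous_Re.
  by move=> c [u v] /=; rewrite mul0r subr0.
apply: (K (@complex.Im R)); first exact: continuous_Im.
by move=> c [u v] /=; rewrite mul0r addr0.
Qed.

(** Implicit differentiation for a root assumed only continuous: the exact increment of F, zero
    along the roots, expresses the difference quotient of [s] through slopes that converge. *)
Lemma has_deriv_root (R : realType) (F : {poly {poly {poly R[i]}}})
    (x1 x2 s : R -> R[i]^o) (t : R) (d1 d2 : R[i]) :
  size F = 3%N -> size (as_poly_x1 F) = 3%N -> size (as_poly_x2 F) = 3%N ->
  has_deriv x1 t d1 -> has_deriv x2 t d2 -> {for t, continuous s} ->
  (\forall u \near t, eval3 F (x1 u) (x2 u) (s u) = 0) ->
  slope F (x1 t) (x2 t) (s t) (s t) != 0 ->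
  has_deriv s t (- (d1 * slope (as_poly_x1 F) (s t) (x2 t) (x1 t) (x1 t) +
                    d2 * slope (as_poly_x2 F) (s t) (x1 t) (x2 t) (x2 t)) /
                 slope F (x1 t) (x2 t) (s t) (s t)).
Proof.
move=> sF s1 s2 hx1 hx2 sc F0 S0.
have st := cvg_shift_dnbhs sc.
have x1t := cvg_shift_dnbhs (has_deriv_continuous hx1).
have x2t := cvg_shift_dnbhs (has_deriv_continuous hx2).
have cst (c : R[i]^o) : (fun=> c) @ (0 : R)^' --> c by exact: cvg_csto.
(* The mixture of arguments at $t$ and at $t+h$ is that of the telescoping in [eval3B]. *)
pose proof (cvg_slope (as_poly_x1 F) st x2t x1t (cst (x1 t))) as S1.
pose proof (cvg_slope (as_poly_x2 F) st (cst (x1 t)) x2t (cst (x2 t))) as S2.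
pose proof (cvg_slope F (cst (x1 t)) (cst (x2 t)) st (cst (s t))) as S3.
pose proof (cvgMo (cvgNo (cvgDo (cvgMo hx1 S1) (cvgMo hx2 S2))) (cvgVo S0 S3)) as L.
rewrite /has_deriv; refine (cvg_eq_near _ L); near=> h => /=.
have S3h : slope F (x1 t) (x2 t) (s (t + h)) (s t) != 0.
  near: h; exact: (cvgr_neq0 _ S3 S0).
have Fh : eval3 F (x1 (t + h)) (x2 (t + h)) (s (t + h)) = 0.
  near: h; exact: (cvg_shift_dnbhs (T := R) (f := id) (t := t) (l := t) _ F0).
have Ft : eval3 F (x1 t) (x2 t) (s t) = 0 by exact: nbhs_singleton F0.
apply: (mulIf S3h); rewrite divfK //.
have : (x1 (t + h) - x1 t) * slope (as_poly_x1 F) (s (t + h)) (x2 (t + h)) (x1 (t + h)) (x1 t) +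
  (x2 (t + h) - x2 t) * slope (as_poly_x2 F) (s (t + h)) (x1 t) (x2 (t + h)) (x2 t) +
  (s (t + h) - s t) * slope F (x1 t) (x2 t) (s (t + h)) (s t) = 0.
  by rewrite -eval3B // Fh Ft subrr.
move=> /eqP; rewrite addr_eq0 => /eqP e.
set q := (h%:C)%C^-1.
have -> (a b c d : R[i]) : - (q * a * b + q * c * d) = - q * (a * b + c * d) by ring.
by rewrite e; ring.
Unshelve. all: by end_near. Qed.

Lemma cvg_conjo (K : numClosedFieldType) (T : Type) (G : set_system T) {FG : Filter G}
    (f : T -> K^o) (a : K^o) :
  f @ G --> a -> (fun u => (f u)^* : K^o) @ G --> (a^* : K^o).
Proof.
by move=> fa; exact: (@cvg_comp _ _ _ f (@Num.conj_op K : K^o -> K^o) _ _ _ fa (@continuous_conj K a)).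
Qed.

Lemma cvg_blend (K : numClosedFieldType) (T : Type) (G : set_system T) {FG : Filter G}
    (a U v W : T -> K^o) (a0 U0 v0 W0 : K^o) :
  (a0 != 0) || (v0 != 0) ->
  a @ G --> a0 -> U @ G --> U0 -> v @ G --> v0 -> W @ G --> W0 ->
  (fun u => blend (a u) (U u) (v u) (W u) : K^o) @ G --> (blend a0 U0 v0 W0 : K^o).
Proof.
move=> /blend_denom d0 ha hU hv hW.
pose proof (cvg_conjo ha) as ha'; pose proof (cvg_conjo hv) as hv'.
exact: cvgMo (cvgDo (cvgMo hU ha') (cvgMo hW hv'))
  (cvgVo d0 (cvgDo (cvgMo ha ha') (cvgMo hv hv'))).
Qed.

Lemma has_deriv_half (R : realType) (f : R -> R[i]^o) (t : R) (v : R[i]) :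
  has_deriv (fun u => 2 * f u) t v -> has_deriv f t (2^-1 * v).
Proof.
move=> /has_derivZ -/(_ 2^-1).
have two0 : 2 != 0 :> R[i] by rewrite pnatr_eq0.
rewrite (_ : (fun u => _) = f) //.
by apply/funext => u; rewrite (mulKf two0).
Qed.

(** * The separated equation for each root, and the Abel sums *)

Lemma quad_roots (K : fieldType) (A B C s s' : K) :
  A * s ^+ 2 + B * s + C = 0 -> A * s' ^+ 2 + B * s' + C = 0 -> s != s' ->
  B = - (A * (s + s')) /\ C = A * (s * s').
Proof.
move=> rs rs' ss; have d0 : s - s' != 0 by rewrite subr_eq0.
have hB : B = - (A * (s + s')).
  apply/eqP; rewrite -addr_eq0; apply/eqP/(mulIf d0).
  have -> : (B + A * (s + s')) * (s - s') =
    (A * s ^+ 2 + B * s + C) - (A * s' ^+ 2 + B * s' + C) by ring.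
  by rewrite rs rs' subrr mul0r.
split=> //; move: rs; rewrite hB => /eqP; rewrite addrC addr_eq0 => /eqP ->; ring.
Qed.

(** One root [s] is followed, with [s'] the other one; exchanging them gives the second equation.
    The conclusion is free of denominators, so it makes sense where $s'=0$. *)
Lemma abel_velocity (R : realType) (F : {poly {poly {poly R[i]}}}) (P J : {poly R[i]})
    (eps k : R[i]) (m g_r g_g3 : state R[i] -> R[i]) (I : set R)
    (z : R -> state R[i]) (f1 f2 s s' : R -> R[i]^o) :
  discriminantly_separable F P J -> eps ^+ 2 = 1 ->
  (forall x1 x2 s, coefA F x1 x2 != 0 -> eval3 F x1 x2 s = 0 ->
    slope (as_poly_x1 F) s x2 x1 x1 * slope (as_poly_x2 F) s x1 x2 x2 =
    eps * (2 * J.[s] * slope F x1 x2 s s)) ->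
  k != 0 -> open I ->
  (forall t, I t -> solves_at F P (- eps) m g_r g_g3 z f1 f2 t) ->
  (forall t, I t -> ve1 (z t) * ve2 (z t) = k ^+ 2) ->
  (forall t, I t -> separation_at F (J * ('X - k%:P) * ('X + k%:P)) z s s' t) ->
  exists y : R -> R[i]^o, forall t, I t ->
    [/\ {for t, continuous y}, y t ^+ 2 = (J * ('X - k%:P) * ('X + k%:P)).[s t] &
      exists2 d : R[i], has_deriv s t d & k * (s t - s' t) * d = s' t * y t].
Proof.
move=> ds eps2 hmul k0 Io sol ek sep.
pose x1 u : R[i]^o := vx1 (z u); pose x2 u : R[i]^o := vx2 (z u).
pose e1 u : R[i]^o := ve1 (z u); pose e2 u : R[i]^o := ve2 (z u).
pose A u : R[i]^o := coefA F (x1 u) (x2 u).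
pose g1 u : R[i]^o := slope (as_poly_x1 F) (s u) (x2 u) (x1 u) (x1 u).
pose g2 u : R[i]^o := slope (as_poly_x2 F) (s u) (x1 u) (x2 u) (x2 u).
pose U u : R[i]^o := g1 u * f1 u - g2 u * f2 u.
pose V u : R[i]^o := g1 u * f1 u + g2 u * f2 u.
pose D u : R[i]^o := P.[x1 u] / e1 u - P.[x2 u] / e2 u.
pose a u : R[i]^o := A u * s' u.
pose W u : R[i]^o := 4 * J.[s u] * s u * D u.
(* With $k^2Q^2=4J(s)(k^2-s^2)$ for the blend $Q$, this constant gives $(cQ)^2=J(s)(s^2-k^2)$. *)
pose c : R[i]^o := 'i * k / 2.
exists (fun u => c * blend (a u) (U u) (V u) (W u)) => t It.
have St := sol t It; have Sp := sep t It.
have ev : eval3 F (x1 t) (x2 t) (s t) = 0 by exact: sep_root1 Sp.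
have ev' : eval3 F (x1 t) (x2 t) (s' t) = 0 by exact: sep_root2 Sp.
have A0 : A t != 0 by exact: sep_lead Sp.
have ss : s t != s' t by exact: sep_neq Sp.
have sF := ds_deg_s ds.
have [hB hC] : Defs.coefB F (x1 t) (x2 t) = - (A t * (s t + s' t)) /\
    Defs.coefC F (x1 t) (x2 t) = A t * (s t * s' t).
  by apply: quad_roots ss; [move: ev | move: ev']; rewrite eval3_quad_s.
have PhiE : (J * ('X - k%:P) * ('X + k%:P)).[s t] = J.[s t] * (s t ^+ 2 - k ^+ 2).
  by rewrite !hornerE; ring.
have Phi0 : J.[s t] * (s t ^+ 2 - k ^+ 2) != 0 by rewrite -PhiE; exact: sep_Phi1 Sp.
have hg1 := sqr_slope_x1 (x1 t) (x2 t) (s t) ds; rewrite ev mulr0 addr0 in hg1.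
have hg2 := sqr_slope_x2 (x1 t) (x2 t) (s t) ds; rewrite ev mulr0 addr0 in hg2.
have hgg := hmul _ _ _ A0 ev; rewrite (slope_coef F) in hgg.
have two0 : 2 != 0 :> R[i] by rewrite pnatr_eq0.
have [hUV hU hV hD] := kotter_sqr (sol_e1_neq0 St) (sol_e2_neq0 St) (ek t It)
  (sol_f1 St) (sol_f2 St) (sol_branch St) (sol_integral St) hB hC
  (disc_s (x1 t) (x2 t) ds) hg1 hg2 hgg eps2 two0.
have [nz Qa Q2] := blend_sqr A0 k0 ss Phi0 hUV hU hV hD.
have hx1 : has_deriv x1 t (2^-1 * (- 'i * f1 t)) by exact: has_deriv_half (sol_x1 St).
have hx2 : has_deriv x2 t (2^-1 * ('i * f2 t)) by exact: has_deriv_half (sol_x2 St).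
have sc : s @ t --> s t by exact: sep_cont1 Sp.
split.
- have s'c : s' @ t --> s' t by exact: sep_cont2 Sp.
  have x1c : x1 @ t --> x1 t by exact: has_deriv_continuous hx1.
  have x2c : x2 @ t --> x2 t by exact: has_deriv_continuous hx2.
  have e1c : e1 @ t --> e1 t by exact: has_deriv_continuous (sol_e1 St).
  have e2c : e2 @ t --> e2 t by exact: has_deriv_continuous (sol_e2 St).
  have f1c : f1 @ t --> f1 t by exact: sol_f1_cont St.
  have f2c : f2 @ t --> f2 t by exact: sol_f2_cont St.
  have g1c : g1 @ t --> g1 t by exact (cvg_slope (as_poly_x1 F) sc x2c x1c x1c).
  have g2c : g2 @ t --> g2 t by exact (cvg_slope (as_poly_x2 F) sc x1c x2c x2c).
  pose proof (cvgMo g1c f1c) as gf1; pose proof (cvgMo g2c f2c) as gf2.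
  have Uc : U @ t --> U t by exact (cvgDo gf1 (cvgNo gf2)).
  have Vc : V @ t --> V t by exact (cvgDo gf1 gf2).
  have ac : a @ t --> a t by exact (cvgMo (cvg_horner2 (F`_2) x1c x2c) s'c).
  have Dc : D @ t --> D t.
    exact (cvgDo (cvgMo (cvg_horner P x1c) (cvgVo (sol_e1_neq0 St) e1c))
      (cvgNo (cvgMo (cvg_horner P x2c) (cvgVo (sol_e2_neq0 St) e2c)))).
  have Wc : W @ t --> W t.
    exact (cvgMo (cvgMo (cvgMo (cvg_csto (4 : R[i]^o)) (cvg_horner J sc)) sc) Dc).
  exact (cvgMo (cvg_csto c) (cvg_blend nz ac Uc Vc Wc)).
- rewrite PhiE; apply: (mulfI (two0 : (2 : R[i]) != 0)).
  have -> : 2 * (c * blend (a t) (U t) (V t) (W t)) ^+ 2 =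
    2 * ('i ^+ 2 / 4 * (k ^+ 2 * blend (a t) (U t) (V t) (W t) ^+ 2)).
    by rewrite /c; field.
  by rewrite [k ^+ 2 * _]Q2 sqrCi; field.
have S0 : slope F (x1 t) (x2 t) (s t) (s t) = A t * (s t - s' t).
  by rewrite (slope_coef F) hB -/(A t); ring.
have S0n : slope F (x1 t) (x2 t) (s t) (s t) != 0.
  by rewrite S0 mulf_neq0 // subr_eq0.
have Fnear : \forall u \near t, eval3 F (x1 u) (x2 u) (s u) = 0.
  have : nbhs t I by exact: open_nbhs_nbhs.
  by apply: filterS => u Iu; exact: sep_root1 (sep u Iu).
have := has_deriv_root sF (ds_deg_x1 ds) (ds_deg_x2 ds) hx1 hx2 sc Fnear S0n.
set d := (X in has_deriv s t X) => hs; exists d => //.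
(* The rates $\dot x_1=-if_1/2$ and $\dot x_2=if_2/2$ combine into $U=g_1f_1-g_2f_2$. *)
have dE : d = 'i / 2 * U t / (A t * (s t - s' t)) by rewrite /d S0 /U /g1 /g2; ring.
clearbody d; set Q := blend _ _ _ _.
(* This factorization holds also at $s'=0$, where $U$ vanishes, so the velocity needs no case
   distinction. *)
have {}Qa : U t = Q * (A t * s' t) by rewrite Qa.
rewrite dE Qa /c; clearbody Q.
have d0 : s t - s' t != 0 by rewrite subr_eq0.
by field; rewrite d0 A0.
Qed.

Lemma div_of_mul_eq (K : fieldType) (k s s' d y : K) :
  k != 0 -> s != s' -> y != 0 -> k * (s - s') * d = s' * y ->
  d / y = s' / (k * (s - s')).
Proof.
move=> k0 ss y0 h; have ss0 : s - s' != 0 by rewrite subr_eq0.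
apply: (mulIf y0); rewrite divfK //; apply: (mulfI (mulf_neq0 k0 ss0)).
by rewrite h; field; rewrite ss0 k0.
Qed.

(** Irreducibility makes the sign global, so [sg] is fixed before [m], [k] and the solution. *)
Theorem proposition5 (R : realType) (F : {poly {poly {poly R[i]}}})
    (P J : {poly R[i]}) :
  discriminantly_separable F P J ->
  irreducible_poly F ->
  exists2 sg : R[i], sg ^+ 2 = 1 &
    forall (m g_r g_g3 : state R[i] -> R[i]) (k : R[i]),
      linearized_on_jacobian F (J * ('X - k%:P) * ('X + k%:P))
        (solution_on F P sg m g_r g_g3 k).
Proof.
move=> ds irr; have [eps eps2 hmul] := slope_mul ds irr.
exists (- eps) => [|m g_r g_g3 k]; first by rewrite sqrrN.
case: (eqVneq k 0) => [k0|k0].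
  (* For $k=0$ there is no solution, because $e_1$ and $e_2$ do not vanish; any nonzero pair
     serves. *)
  exists 1, 0; split; first by rewrite xpair_eqE oner_eq0.
  move=> I z s1 s2 _ _ [[f1 [f2 sol]] [t0 It0 /eqP]].
  rewrite k0 expr0n mulf_eq0.
  by rewrite (negPf (sol_e1_neq0 (sol t0 It0))) (negPf (sol_e2_neq0 (sol t0 It0))).
(* With $\dot s_1/y_1=s_2/(k(s_1-s_2))$ and its mirror image, the sum is $-1/k$; weighted by $s_1$
   and $s_2$ the two terms cancel. *)
exists (- k^-1), 0; split; first by rewrite xpair_eqE oppr_eq0 invr_eq0 (negPf k0).
move=> I z s1 s2 Io Iitv [[f1 [f2 sol]] [t0 It0 ek0]] sep.
have ek t : I t -> ve1 (z t) * ve2 (z t) = k ^+ 2.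
  move=> It; rewrite -ek0.
  (* The terms $-m\,e_1e_2$ and $m\,e_1e_2$ of the derivative cancel. *)
  apply: (@has_deriv0_cst R (fun u => ve1 (z u) * ve2 (z u)) I) => // u Iu.
  have := has_derivM (sol_e1 (sol u Iu)) (sol_e2 (sol u Iu)).
  by congr has_deriv; ring.
have sep' t : I t -> separation_at F (J * ('X - k%:P) * ('X + k%:P)) z s2 s1 t.
  by case/sep => *; split => //; rewrite eq_sym.
have [y1 hy1] := abel_velocity ds eps2 hmul k0 Io sol ek sep.
have [y2 hy2] := abel_velocity ds eps2 hmul k0 Io sol ek sep'.
exists y1, y2 => t It.
have [y1c y1P [d1 sd1 hd1]] := hy1 t It; have [y2c y2P [d2 sd2 hd2]] := hy2 t It.
split=> //; exists d1, d2.
have Sp := sep t It; have ss := sep_neq Sp; have ss' := sep_neq (sep' t It).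
have ss0 : s1 t - s2 t != 0 by rewrite subr_eq0.
have y10 : y1 t != 0 by have := sep_Phi1 Sp; rewrite -y1P expf_eq0.
have y20 : y2 t != 0 by have := sep_Phi2 Sp; rewrite -y2P expf_eq0.
have e1 := div_of_mul_eq k0 ss y10 hd1; have e2 := div_of_mul_eq k0 ss' y20 hd2.
have ss0' : s2 t - s1 t != 0 by rewrite subr_eq0.
split=> //; rewrite -?mulrA e1 e2; field; by rewrite ?k0 ?ss0 ?ss0'.
Qed.
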